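(* Consider a structured problem in the class $\mathcal{SP}(m_f,\sigma_f,\bar\sigma_f,L,\delta)$ with $L(\cdot)=L\ge0$ and $\delta(\cdot,\cdot)=\delta\ge0$ constant and $L>\bar\sigma_f\sigma_d$. Let $\{(z_{k-1},w_{k-1},x_k,\hat x_k)\}_{k\ge0}$ be generated by the classical method of Method S with $$\beta_k\equiv\frac{L-\bar\sigma_f\sigma_d}{\sigma_d}\ (k\ge-1),\qquad\lambda_0=1,\qquad\lambda_{k+1}=\frac{\beta_k+S_k\sigma_f}{\beta_k}\ (k\ge0).$$ Then, for every $k\ge0$, $$f(\hat x_k)-f(x^* )+\sigma_f\xi(z_k,x^* )\le\frac{L-\bar\sigma_f\sigma_d}{\sigma_d}\,l_d(z_k;x^* )\min\left\{\left(1-\frac{\sigma_f\sigma_d}{L-\bar\sigma_f\sigma_d+\sigma_f\sigma_d}\right)^k,\frac1{k+1}\right\}+\delta.$$ Furthermore, the left-hand side can be replaced by $\frac1{S_k}\sum_{i=0}^k\lambda_if(w_i)-f(x^* )+\sigma_f\xi(z_k,x^* )$ or by $\min_{0\le i\le k}f(w_i)-f(x^* )+\sigma_f\xi(z_k,x^* )$.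
   Context: Setting. $E$ is a finite-dimensional real normed space with norm $\|\cdot\|$; $E^*$ is its dual, with pairing $\langle s,x\rangle$. $Q\subset E$ is a closed convex set and $f:E\to\mathbb R\cup\{+\infty\}$ is a lower-semicontinuous (lsc) convex function with $Q\subset \mathrm{dom} f$. The problem $\min_{x\in Q}f(x)$ is assumed to have an optimal solution; $x^*\in Q$ denotes one. A prox-function $d:E\to\mathbb R\cup\{+\infty\}$ is fixed: $d$ is nonnegative, continuously differentiable and strongly convex on $Q$ ($Q\subset\mathrm{dom}\,d$) with constant $\sigma_d>0$ with respect to $\|\cdot\|$, and $d(x_0)=\min_{x\in Q}d(x)=0$ for its unique minimizer $x_0\in Q$. For $x,y\in Q$: $l_d(y;x):=d(y)+\langle\nabla d(y),x-y\rangle$ and $\xi(y,x):=d(x)-l_d(y;x)$ (Bregman distance). For an lsc convex $\psi:E\to\mathbb R\cup\{+\infty\}$ with $Q\subset\mathrm{dom}\,\psi$, $\sigma(\psi):=\{\tau\ge0:\psi(x)-\tau d(x)\text{ is an lsc convex function on }Q\}$. Class $\mathcal{SP}(m_f,\sigma_f,\bar\sigma_f,L,\delta)$: problems $\min_{x\in Q}f(x)$ for which the following are given. For each $y\in Q$, $m_f(y;\cdot):E\to\mathbb R\cup\{+\infty\}$ is an lsc convex function (with $Q$ in its domain) with $m_f(y;x)\le f(x)$ for all $x\in Q$; $\sigma_f\ge0$ satisfies $\sigma_f\in\sigma(f)\cap\bigcap_{y\in Q}\sigma(m_f(y;\cdot))$; $\bar\sigma_f\in[0,\sigma_f]$; $L(\cdot)\ge0$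 is a function on $Q$; $\delta(y,\cdot)$ is a nonnegative convex function on $Q$ for each $y\in Q$; and $$f(x)\le[m_f(y;x)-\bar\sigma_f\xi(y,x)]+\tfrac{L(y)}2\|y-x\|^2+\delta(y,x)\quad\forall x,y\in Q.$$ Subproblems $\min_{x\in Q}\{m_f(y;x)+\langle s,x\rangle+\beta d(x)\}$ ($\beta\ge0$, $s\in E^*$) are assumed solvable ($Q$ is additionally assumed bounded when $\beta=0$ and $\sigma_f=0$). Parameters. Weight parameters $\lambda_k>0$ ($k\ge0$); scaling parameters $\beta_k\ge0$ ($k\ge-1$), nondecreasing in $k$. $S_k:=\sum_{i=0}^k\lambda_i$, $S_{-1}:=0$. Property 2 for a coupled sequence of functions $\{(\varphi_k(x),\psi_k(x))\}_{k\ge-1}$ (associated with $\{\lambda_k\},\{\beta_k\}$ and test points $\{x_k\}_{k\ge0}$), with $z_k:=\mathrm{argmin}_{x\in Q}\varphi_k(x)$, $w_k:=\mathrm{argmin}_{x\in Q}\psi_k(x)$ (minimizers assumed to exist): (B0) $\varphi_k(x)\ge\psi_k(x)$ for all $x\in Q$, $k\ge -1$. (B1) $\psi_{-1}(w_{-1})=0$ and $z_{-1}=w_{-1}=x_0$. (B2) For all $k\ge-1$, $x\in Q$: $\psi_{k+1}(x)\ge\varphi_k(z_k)+\lambda_{k+1}m_f(x_{k+1};x)+\beta_{k+1}d(x)-\beta_kl_d(z_k;x)+S_k\sigma_f\xi(z_k,x)$. (B3) For all $k\ge-1$: $\psi_k(w_k)\le\min_{x\in Q}\{\sum_{i=0}^k\lambda_im_f(x_i;x)+\beta_kl_d(z_k;x)-S_k\sigma_f\xi(z_k,x)\}$.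 Method S, classical variant. With a coupled sequence $\{(\varphi_k,\psi_k)\}_{k\ge-1}$ satisfying Property 2: set $x_0:=z_{-1}:=w_{-1}:=\mathrm{argmin}_{x\in Q}d(x)$, $z_0:=\mathrm{argmin}_{x\in Q}\varphi_0(x)$, $\hat x_0:=w_0:=\mathrm{argmin}_{x\in Q}\psi_0(x)$. For $k\ge0$ set $x_{k+1}:=z_k$, $z_{k+1}:=\mathrm{argmin}_{x\in Q}\varphi_{k+1}(x)$, $w_{k+1}:=\mathrm{argmin}_{x\in Q}\psi_{k+1}(x)$, $\hat x_{k+1}:=\frac{S_k\hat x_k+\lambda_{k+1}w_{k+1}}{S_{k+1}}$.
   Formalization: The printed bound can fail when l_d(z_k;x* )<0, δ>0, σ_f>0 and k≥1; it is stated, for all three left-hand sides, when l_d(z_k;x* )≥0 or δ=0 or σ_f=0 or k=0, and for every k with 1/S_k in place of min{...}. *)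

(* Defs.v *)
From HB Require Import structures.
From mathcomp Require Import all_boot all_order all_algebra.
From mathcomp Require Import all_classical all_reals all_analysis.

Set Implicit Arguments.
Unset Strict Implicit.
Unset Printing Implicit Defensive.

Import Order.TTheory GRing.Theory Num.Theory.
Import numFieldNormedType.Exports.

Local Open Scope classical_set_scope.
Local Open Scope ring_scope.

(* A vectType is finite-dimensional over its scalars. *)
#[short(type="normedVectType")]
HB.structure Definition NormedVector (R : numDomainType) :=
  {E of Vector R E & NormedModule R E}.

Section ConvexFunctions.
Context {R : realType} {E : normedVectType R}.
Implicit Types (Q : set E) (g : E -> \bar R).
Local Open Scope ereal_scope.

Definition dom g : set E := [set x | g x < +oo].

Definition argmin_on Q g (x : E) : Prop :=
  Q x /\ forall y, Q y -> g x <= g y.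

Definition strongly_convex_on Q g (sigma : R) : Prop :=
  forall x y (t : R), Q x -> Q y -> (0 <= t <= 1)%R ->
  g (t *: x + (1 - t) *: y)%R <=
    t%:E * g x + (1 - t)%:E * g y
    - (sigma / 2 * t * (1 - t) * `|x - y| ^+ 2)%:E.

(* Intended for g with values in R `|` {+oo}; the library convention
   0 * +oo = 0 makes the cases t = 0 and t = 1 trivial. *)
Definition econvex_on Q g : Prop :=
  forall x y (t : R), Q x -> Q y -> (0 <= t <= 1)%R ->
  g (t *: x + (1 - t) *: y)%R <= t%:E * g x + (1 - t)%:E * g y.

Definition lsc_convex g : Prop :=
  [/\ forall x, -oo < g x, lower_semicontinuous g & econvex_on setT g].

(* [subspace Q] carries the topology induced on Q. *)
Definition lsc_convex_on Q g : Prop :=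
  [/\ forall x, Q x -> -oo < g x,
      lower_semicontinuous (g : subspace Q -> \bar R) & econvex_on Q g].

End ConvexFunctions.

Section ProxFunction.
Context {R : realType} {E : normedVectType R}.
Variables (Q : set E) (d : E -> \bar R).
(* The dual of E is {scalar E}, every linear form on E being continuous. *)
Variable gradd : E -> {scalar E}.
Local Open Scope ereal_scope.

Definition l_d (y x : E) : \bar R := d y + (gradd y (x - y)%R)%:E.

Definition bregman (y x : E) : \bar R := d x - l_d y x.

(* gradd is a gradient of d on Q, continuous for the dual norm.  Limits are
   taken inside Q, as Q may have boundary points or an empty interior and d
   may be +oo outside Q. *)
Definition C1_on : Prop :=
  forall y, Q y -> forall eps : R, (0 < eps)%R ->
  \forall x \near within Q (nbhs y),
    `|bregman y x| <= (eps * `|x - y|)%:E /\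
    forall v : E, (`|gradd x v - gradd y v| <= eps * `|v|)%R.

Record prox_function (sigma_d : R) (x0 : E) : Prop := {
  prox_proper : forall x, -oo < d x ;
  prox_dom : Q `<=` dom d ;
  prox_ge0 : forall x, Q x -> 0 <= d x ;
  prox_C1 : C1_on ;
  prox_sigma_gt0 : (0 < sigma_d)%R ;
  prox_strong : strongly_convex_on Q d sigma_d ;
  prox_argmin : argmin_on Q d x0 ;
  prox_unique : forall x, argmin_on Q d x -> x = x0 ;
  prox_min0 : d x0 = 0 }.

Definition sigma_set (psi : E -> \bar R) : set R :=
  [set tau : R | (0 <= tau)%R /\
     lsc_convex_on Q (fun x => psi x - tau%:E * d x)].

Record structured_problem (f : E -> \bar R) (m : E -> E -> \bar R)
    (sigma_f sigmabar_f : R) (L : E -> R) (delta : E -> E -> R) : Prop := {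
  sp_f : lsc_convex f ;
  sp_f_dom : Q `<=` dom f ;
  sp_m : forall y, Q y -> lsc_convex (m y) ;
  sp_m_dom : forall y, Q y -> Q `<=` dom (m y) ;
  sp_m_le : forall y x, Q y -> Q x -> m y x <= f x ;
  sp_sigma_ge0 : (0 <= sigma_f)%R ;
  sp_sigma : (sigma_set f `&` \bigcap_(y in Q) sigma_set (m y)) sigma_f ;
  sp_sigmabar : (0 <= sigmabar_f <= sigma_f)%R ;
  sp_L_ge0 : forall y, Q y -> (0 <= L y)%R ;
  sp_delta_ge0 : forall y x, Q y -> Q x -> (0 <= delta y x)%R ;
  sp_delta_convex : forall y, Q y ->
    convex_function (Q : set (convex_lmodType E)) (delta y) ;
  sp_upper : forall x y, Q x -> Q y ->
    f x <= (m y x - sigmabar_f%:E * bregman y x)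
           + (L y / 2 * `|y - x| ^+ 2)%:E + (delta y x)%:E }.

Definition subproblems_solvable (m : E -> E -> \bar R) (sigma_f : R) : Prop :=
  forall (y : E) (s : {scalar E}) (beta : R), Q y -> (0 <= beta)%R ->
  (beta = 0%R -> sigma_f = 0%R -> bounded_set Q) ->
  exists x, argmin_on Q (fun x => m y x + (s x)%:E + beta%:E * d x) x.

(* Indices: phi, psi, z, w and beta start at -1 on paper and are shifted here,
   so that [phi n] stands for phi_(n-1); lambda, x and xhat are not shifted.
   [weight_sum lambda n] is S_(n-1) = lambda_0 + ... + lambda_(n-1). *)
Definition weight_sum (lambda : nat -> R) (n : nat) : R :=
  (\sum_(i < n) lambda i)%R.

Record coupled_sequence (m : E -> E -> \bar R) (sigma_f : R)
    (lambda beta : nat -> R) (phi psi : nat -> E -> \bar R)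
    (x z w : nat -> E) : Prop := {
  coupled_z : forall n, argmin_on Q (phi n) (z n) ;
  coupled_w : forall n, argmin_on Q (psi n) (w n) ;
  coupled_le : forall n u, Q u -> psi n u <= phi n u ;
  coupled_init : [/\ psi 0%N (w 0%N) = 0, z 0%N = x 0%N & w 0%N = x 0%N] ;
  coupled_step : forall n u, Q u ->
    phi n (z n) + (lambda n)%:E * m (x n) u + (beta n.+1)%:E * d u
      - (beta n)%:E * l_d (z n) u
      + (weight_sum lambda n * sigma_f)%:E * bregman (z n) u <= psi n.+1 u ;
  coupled_upper : forall n,
    psi n (w n) <=
      ereal_inf [set (\sum_(i < n) (lambda i)%:E * m (x i) u)
                     + (beta n)%:E * l_d (z n) u
                     - (weight_sum lambda n * sigma_f)%:E * bregman (z n) u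
                | u in Q] }.

Record classical_method (m : E -> E -> \bar R) (sigma_f : R)
    (lambda beta : nat -> R) (phi psi : nat -> E -> \bar R)
    (x z w xhat : nat -> E) : Prop := {
  method_coupled : coupled_sequence m sigma_f lambda beta phi psi x z w ;
  method_x0 : argmin_on Q d (x 0%N) ;
  method_x : forall k, x k.+1 = z k.+1 ;
  method_xhat0 : xhat 0%N = w 1%N ;
  method_xhat : forall k,
    xhat k.+1 = ((weight_sum lambda k.+2)^-1 *:
      (weight_sum lambda k.+1 *: xhat k + lambda k.+1 *: w k.+2))%R }.

End ProxFunction.

(* Main.v *)
Require Import Defs.
From mathcomp Require Import all_boot all_order all_algebra.
From mathcomp Require Import all_classical all_reals all_analysis.
From mathcomp Require Import ring lra.

Import Order.TTheory GRing.Theory Num.Theory.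
Import numFieldNormedType.Exports.

Local Open Scope classical_set_scope.
Local Open Scope ring_scope.
Local Open Scope ereal_scope.

(** Write b = (L - sigmabar_f sigma_d) / sigma_d.  Since strong convexity gives
    xi(y, x) >= sigma_d / 2 |x - y|^2, the model inequality becomes
    f(x) <= m_f(y; x) + b xi(y, x) + delta, and the weights satisfy
    b lambda_k = b + S_(k-1) sigma_f.  As x_(k+1) = z_k, the step (B2) at w_(k+1)
    therefore adds at least lambda_(k+1) (f(w_(k+1)) - delta) to the minimum of
    psi, so that sum_i lambda_i f(w_i) <= psi_k(w_k) + S_k delta.  Bounding
    psi_k(w_k) from above by (B3) at x* and dividing by S_k gives the estimate
    with 1 / S_k; the recursion S_(k+1) = 1 + (1 + sigma_f / b) S_k yields both
    S_k >= k + 1 and S_k >= (1 + sigma_f / b)^k. *)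

(** * Convexity of [Q] and the quadratic lower bound on the Bregman distance *)

Lemma convex_set_comb (R : realType) (E : normedVectType R) (Q : set E)
    (x y : E) (t : R) :
  convex_set (Q : set (convex_lmodType E)) -> Q x -> Q y -> (0 <= t <= 1)%R ->
  Q (t *: x + (1 - t) *: y)%R.
Proof.
move=> Qconvex Qx Qy /andP[t0 t1].
have := Qconvex x y (Itv01 t0 t1) (mem_set Qx) (mem_set Qy).
by rewrite inE.
Qed.

Section Bregman.
Context {R : realType} {E : normedVectType R}.
Variables (Q : set E) (d : E -> \bar R) (gradd : E -> {scalar E}).
Hypothesis dfin : forall x, Q x -> d x \is a fin_num.

Lemma bregmanE (x y : E) : Q x -> Q y ->
  bregman d gradd y x
  = (fine (d x) - (fine (d y) + gradd y (x - y)))%:E.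
Proof.
by move=> /dfin dx /dfin dy; rewrite /bregman /l_d -(fineK dx) -(fineK dy).
Qed.

(* Along y + t (x - y), strong convexity and differentiability at y give
   xi(y, x) >= (1 - t) sigma / 2 |x - y|^2 - o(1) as t tends to 0. *)
Lemma bregman_ge (sigma : R) (x y : E) :
  convex_set (Q : set (convex_lmodType E)) ->
  C1_on Q d gradd -> strongly_convex_on Q d sigma -> Q x -> Q y ->
  (sigma / 2 * `|x - y| ^+ 2)%:E <= bregman d gradd y x.
Proof.
move=> Qconvex dC1 dstrong Qx Qy; rewrite bregmanE// lee_fin.
set N := `|x - y|%R; set q := (sigma / 2 * N ^+ 2)%R.
have N0 : (0 <= N)%R by exact: normr_ge0.
have q0 : (0 <= `|q|)%R by exact: normr_ge0.
apply/ler_addgt0Pr => e e0.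
(* Half of the error [e] pays for the differentiability remainder [eps * N]; adding 1 to [N] keeps
   the divisor positive when [x = y]. *)
pose eps := (e / 2 / (N + 1))%R.
have eps0 : (0 < eps)%R by rewrite /eps !divr_gt0//; lra.
have [r /= r0 near_y] : exists2 r : R, (0 < r)%R & forall x', (`|y - x'| < r)%R ->
    Q x' -> `|bregman d gradd y x'| <= (eps * `|x' - y|)%:E.
  have /nbhs_normP[r /= r0 hr] := dC1 y Qy eps eps0.
  by exists r => // x' yx' Qx'; have [] := hr x' yx' Qx'.
(* The three bounds on [t] serve, in order, to stay on the segment, to stay in the neighbourhood of
   [y], and to make the loss [t * q] at most [e / 2]. *)
pose t := Num.min 1%R (Num.min (r / 2 / (N + 1)) (e / 2 / (`|q| + 1)))%R.
have t0 : (0 < t)%R by rewrite /t !lt_min ltr01 !divr_gt0//; lra.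
have t1 : (t <= 1)%R by rewrite /t !ge_min lexx.
have tN : (t * N < r)%R.
  have : (t <= r / 2 / (N + 1))%R by rewrite /t !ge_min lexx !orbT.
  rewrite ler_pdivlMr; last lra.
  by move=> h; nra.
have tq : (t * `|q| <= e / 2)%R.
  have : (t <= e / 2 / (`|q| + 1))%R by rewrite /t !ge_min lexx !orbT.
  rewrite ler_pdivlMr; last lra.
  by move=> h; nra.
have epsN : (eps * N <= e / 2)%R.
  have : (eps * (N + 1) = e / 2)%R by rewrite /eps divfK//; lra.
  by move=> h; nra.
have t01 : (0 <= t <= 1)%R by rewrite (ltW t0).
pose x' := (t *: x + (1 - t) *: y)%R.
have Qx' : Q x' by exact: convex_set_comb.
have x'y : (x' - y = t *: (x - y))%R.
  by rewrite /x' scalerBl scale1r scalerBr addrA addrAC addrK.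
have Nx' : (`|x' - y| = t * N)%R by rewrite x'y normrZ gtr0_norm.
have := near_y x'; rewrite distrC Nx' => /(_ tN Qx').
rewrite bregmanE// x'y linearZ/= -abse_EFin/= lee_fin => /ler_normlP[+ _].
have := dstrong x y t Qx Qy t01.
rewrite -/x' -(fineK (dfin _ Qx)) -(fineK (dfin _ Qy)) -(fineK (dfin _ Qx')).
rewrite -!EFinM -!EFinD lee_fin -/N.
rewrite (_ : (sigma / 2 * t * (1 - t) * N ^+ 2 = t * ((1 - t) * q))%R); last first.
  by rewrite /q; ring.
set a := fine _; set b := fine (d x); set c := fine (d y).
rewrite /GRing.scale/=.
set g := (gradd y _ : R) => h1 h2.
(* [h1] bounds [d x'] from above and [h2] from below; comparing them leaves a common factor [t > 0]
   to cancel. *)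
have h3 : (t * ((1 - t) * q - eps * N) <= t * (b - (c + g)))%R by nra.
have {}h3 : ((1 - t) * q - eps * N <= b - (c + g))%R by rewrite -(ler_pM2l t0).
have tqq : (t * q <= t * `|q|)%R by rewrite ler_pM2l// ler_norm.
by lra.
Qed.

End Bregman.

(** * Growth of the weight sums *)

Section WeightSum.
Context {R : realType}.
Implicit Types (lambda : nat -> R).
Local Open Scope ring_scope.

Lemma weight_sumS lambda n :
  weight_sum lambda n.+1 = weight_sum lambda n + lambda n.
Proof. by rewrite /weight_sum big_ord_recr. Qed.

Lemma weight_sum_gt0 lambda n :
  (forall i, 0 < lambda i) -> 0 < weight_sum lambda n.+1.
Proof.
move=> l0; elim: n => [|n IHn]; first by rewrite /weight_sum big_ord1.
by rewrite weight_sumS addr_gt0.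
Qed.

(** Once the preceding sum is nonnegative, the recursion gives [b * lambda n >= b], so each weight
    is at least 1. *)
Lemma weight_sum_ge_nat (b sigma : R) lambda :
  0 < b -> 0 <= sigma ->
  (forall n, b * lambda n = b + weight_sum lambda n * sigma) ->
  forall n, n%:R <= weight_sum lambda n.
Proof.
move=> b0 sigma0 lambdaE; elim=> [|n IHn]; first by rewrite /weight_sum big_ord0.
have S0 : 0 <= weight_sum lambda n by exact: le_trans IHn.
rewrite weight_sumS -natr1 lerD// -(ler_pM2l b0) lambdaE mulr1 lerDl.
exact: mulr_ge0.
Qed.

(** Covers the case [sigma_f = 0], where [1 / S] is exactly [1 / k.+1]. *)
Lemma weight_sum_nat (b : R) lambda :
  b != 0 -> (forall n, b * lambda n = b) ->
  forall n, weight_sum lambda n = n%:R.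
Proof.
move=> b0 lambdaE n; rewrite /weight_sum (eq_bigr (fun=> 1)).
  by rewrite sumr_const card_ord.
by move=> i _; apply: (mulfI b0); rewrite mulr1.
Qed.

Lemma inv_weight_sum_le (b sigma : R) lambda :
  0 < b -> 0 <= sigma ->
  (forall n, b * lambda n = b + weight_sum lambda n * sigma) ->
  forall k, 1 / weight_sum lambda k.+1 <=
    Num.min ((b / (b + sigma)) ^+ k) (1 / k.+1%:R).
Proof.
move=> b0 sigma0 lambdaE k.
have ge_nat := weight_sum_ge_nat _ _ _ b0 sigma0 lambdaE.
have S0 n : 0 < weight_sum lambda n.+1 by exact: lt_le_trans (ge_nat _).
rewrite le_min; apply/andP; split; last first.
  by rewrite !div1r lef_pV2 ?posrE.
rewrite -(invf_div (b + sigma)) exprVn div1r lef_pV2 ?posrE//; last first.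
  by rewrite exprn_gt0// divr_gt0// ltr_wpDr.
elim: k => [|k IHk]; first by rewrite expr0 -[leLHS]/(1%:R).
rewrite exprS weight_sumS.
have -> : lambda k.+1 = 1 + weight_sum lambda k.+1 * sigma / b.
  by apply: (mulfI (lt0r_neq0 b0)); rewrite lambdaE; field; rewrite gt_eqF.
(* The next sum is 1 plus [(b + sigma) / b] times the current one; the 1 is dropped. *)
have : (b + sigma) / b * ((b + sigma) / b) ^+ k
    <= (b + sigma) / b * weight_sum lambda k.+1.
  by rewrite ler_wpM2l// divr_ge0 ?addr_ge0 ?(ltW b0).
move/le_trans; apply.
rewrite mulrDl divff ?gt_eqF// mulrDl mul1r (mulrAC sigma).
by rewrite (mulrC sigma) lerD2l lerDr.
Qed.

End WeightSum.

(** * Comparison with weighted means of values *)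

Lemma bigmin_le_weighted_mean (R : realType) (lambda F : nat -> R) k :
  (forall i, 0 < lambda i)%R ->
  \big[Order.min/+oo]_(i < k.+1) (F i)%:E
  <= ((\sum_(i < k.+1) lambda i * F i) / weight_sum lambda k.+1)%:E.
Proof.
move=> lambda0; set best := \big[_/_]_(_ < _) _.
have best_le (i : 'I_k.+1) : best <= (F i)%:E by exact: bigmin_le.
(* The neutral element [+oo] is never attained, since the index 0 always contributes. *)
have best_fin : best \is a fin_num.
  rewrite fin_numE gt_eqF/=; last by apply: lt_bigmin => // i _; rewrite ltNyr.
  by rewrite lt_eqF// (le_lt_trans (best_le ord0))// ltry.
rewrite -(fineK best_fin) lee_fin ler_pdivlMr ?weight_sum_gt0//.
rewrite /weight_sum mulr_sumr ler_sum// => i _.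
by rewrite mulrC ler_wpM2l ?(ltW (lambda0 _))// -lee_fin fineK.
Qed.

(** Jensen's inequality in recursive form: [xhat k.+1] is the convex combination of [xhat k] and
    [w k.+1] with coefficient [S / S']. *)
Lemma convex_weighted_mean (R : realType) (E : normedVectType R)
    (f : E -> \bar R) (lambda F : nat -> R) (w xhat : nat -> E) :
  econvex_on setT f -> (forall i, -oo < f (xhat i)) ->
  (forall i, 0 < lambda i)%R ->
  (forall i, f (w i) = (F i)%:E) -> xhat 0%N = w 0%N ->
  (forall k, xhat k.+1 = (weight_sum lambda k.+2)^-1 *:
     (weight_sum lambda k.+1 *: xhat k + lambda k.+1 *: w k.+1))%R ->
  forall k, f (xhat k) <=
    ((\sum_(i < k.+1) lambda i * F i) / weight_sum lambda k.+1)%:E.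
Proof.
move=> fconvex fNy lambda0 fw xhat0 xhatS; elim=> [|k IHk].
  rewrite xhat0 fw /weight_sum !big_ord1 mulrAC divff ?mul1r// gt_eqF//.
set S := weight_sum lambda k.+1 in IHk xhatS *.
set S' := weight_sum lambda k.+2.
have S0 : (0 < S)%R by exact: weight_sum_gt0.
have S'0 : (0 < S')%R by exact: weight_sum_gt0.
have S'E : S' = (S + lambda k.+1)%R by rewrite /S' weight_sumS.
have l0 := lambda0 k.+1.
have xhatE : xhat k.+1 = (S / S' *: xhat k + (1 - S / S') *: w k.+1)%R.
  rewrite xhatS -/S' scalerDr !scalerA (mulrC S); congr (_ + _ *: _)%R.
  by rewrite S'E; field; rewrite gt_eqF// addr_gt0.
have SS' : (0 <= S / S' <= 1)%R.
  by rewrite divr_ge0 ?(ltW S0) ?(ltW S'0)//= ler_pdivrMr// mul1r S'E lerDl ltW.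
have := fconvex (xhat k) (w k.+1) _ I I SS'.
rewrite -xhatE fw => /le_trans; apply.
have fin : f (xhat k) \is a fin_num.
  by rewrite fin_numE gt_eqF// lt_eqF// (le_lt_trans IHk) ?ltry.
move: IHk; rewrite -(fineK fin) -!EFinM -EFinD !lee_fin => IHk.
rewrite big_ord_recr/=.
set A := (\sum_(i < k.+1) _)%R in IHk *.
move: IHk; rewrite ler_pdivlMr// ler_pdivlMr// => IHk.
rewrite -[leLHS](_ : S * fine (f (xhat k)) + (S' - S) * F k.+1 = _)%R; last first.
  by field; rewrite gt_eqF.
have -> : (S' - S = lambda k.+1)%R by rewrite S'E; ring.
by rewrite lerD// mulrC.
Qed.

(** * Lower and upper estimates along the coupled sequence *)

Section EstimateSequence.
Context {R : realType} {E : normedVectType R}.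
Variables (Q : set E) (d : E -> \bar R) (gradd : E -> {scalar E}).
Variables (f : E -> \bar R) (m : E -> E -> \bar R).
Hypothesis dfin : forall u, Q u -> d u \is a fin_num.
Hypothesis ffin : forall u, Q u -> f u \is a fin_num.
Hypothesis mfin : forall y u, Q y -> Q u -> m y u \is a fin_num.
Hypothesis m_le : forall y u, Q y -> Q u -> m y u <= f u.

Variables (sigma_f b delta : R) (lambda beta : nat -> R).
Hypothesis f_le : forall y u, Q y -> Q u ->
  f u <= m y u + b%:E * bregman d gradd y u + delta%:E.
Hypothesis betaE : forall n, beta n = b.
Hypothesis lambda_gt0 : forall n, (0 < lambda n)%R.
Hypothesis lambdaE : forall n,
  (b * lambda n = b + weight_sum lambda n * sigma_f)%R.

Variables (phi psi : nat -> E -> \bar R) (x z w xhat : nat -> E).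
Hypothesis hmethod :
  classical_method Q d gradd m sigma_f lambda beta phi psi x z w xhat.

Let F u := fine (f u).

Lemma weighted_values_le_psi n :
  (\sum_(i < n) lambda i * F (w i.+1) - weight_sum lambda n * delta)%:E
  <= psi n (w n).
Proof.
have [[zmin wmin psi_phi [psi0 z0 _] step _] _ xz _ _] := hmethod.
elim: n => [|n IHn].
  by rewrite psi0 /weight_sum !big_ord0 mul0r subr0.
have [Qz _] := zmin n; have [Qw _] := wmin n.+1.
have xn : x n = z n by case: n {IHn Qz Qw} => [|n]; [rewrite z0|exact: xz].
apply: le_trans (step n _ Qw); rewrite xn !betaE.
(* The induction passes from [psi] to [phi] through [psi n (w n) <= psi n (z n) <= phi n (z n)]. *)
have phi_ge := le_trans IHn (le_trans (proj2 (wmin n) _ Qz) (psi_phi n _ Qz)).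
have fw := f_le _ _ Qz Qw.
rewrite -!addeA; apply: le_trans (leeD2r _ phi_ge).
move: fw; rewrite /l_d (bregmanE _ _ _ dfin)//.
rewrite -(fineK (ffin _ Qw)) -(fineK (mfin _ _ Qz Qw)).
rewrite -(fineK (dfin _ Qw)) -(fineK (dfin _ Qz)) -/(F _).
rewrite -?(EFinM, EFinD, EFinN) !lee_fin.
rewrite big_ord_recr/= weight_sumS.
set xi := (fine (d (w n.+1)) - _)%R => fw.
have := ler_wpM2l (ltW (lambda_gt0 n)) fw.
have := lambdaE n.
rewrite /xi.
set S := weight_sum _ _; set l := lambda n; set A := (\sum_(_ < _) _)%R.
set a1 := fine _; set a2 := fine _; set g := (gradd _ _ : R).
set a3 := F _; set a4 := fine _ => hl h.
(* The prox terms of the step add up to [b + S * sigma_f] times the Bregman distance, which is what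
   the weighted model inequality consumes. *)
have e : (l * (b * (a2 - (a4 + g))) = (b + S * sigma_f) * (a2 - (a4 + g)))%R.
  by rewrite -hl; ring.
by nra.
Qed.

(** The infimum bounding [psi n (w n)] is evaluated at [u], and each model value there is at most
    [f u]. *)
Lemma weighted_values_le n u : Q u ->
  (\sum_(i < n) lambda i * F (w i.+1)
   <= weight_sum lambda n * (F u + delta)
      + b * fine (l_d d gradd (z n) u)
      - weight_sum lambda n * sigma_f * fine (bregman d gradd (z n) u))%R.
Proof.
move=> Qu.
have [[zmin wmin psi_phi [psi0 z0 _] _ upper] _ xz _ _] := hmethod.
have Qz i : Q (z i) by have [] := zmin i.
have xn i : x i = z i by case: i => [|i]; [rewrite z0|exact: xz].
have := le_trans (weighted_values_le_psi n) (upper n).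
move/le_trans => /(_ _ (ereal_inf_lbound _)) => /(_ _ (ex_intro2 _ _ u Qu erefl)).
have sumE : \sum_(i < n) (lambda i)%:E * m (x i) u
    = (\sum_(i < n) lambda i * fine (m (x i) u))%:E.
  rewrite -sumEFin; apply: eq_bigr => i _.
  by rewrite EFinM fineK// mfin// xn.
have ldfin : l_d d gradd (z n) u \is a fin_num.
  by rewrite /l_d fin_numD dfin//=.
rewrite sumE betaE -(fineK ldfin) (bregmanE _ _ _ dfin)//.
rewrite -?(EFinM, EFinD, EFinN) lee_fin/=.
have : (\sum_(i < n) lambda i * fine (m (x i) u) <= weight_sum lambda n * F u)%R.
  rewrite /weight_sum mulr_suml ler_sum// => i _.
  rewrite ler_wpM2l ?(ltW (lambda_gt0 i))//.
  by rewrite xn /F; apply: fine_le; rewrite ?mfin ?ffin ?m_le.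
by lra.
Qed.

End EstimateSequence.

(* The factor min{...} bounds 1/S_k from above, so it may replace 1/S_k only
   where l_d(z_k; x^* ) is nonnegative or min{...} = 1/S_k; nonnegativity is
   automatic when delta = 0, but can fail when delta > 0, and the bound with
   min{...} then fails too.  Outside this case the bound with min{...} is
   asserted; the bound with 1/S_k is asserted for all k. *)
Theorem theorem5p2 (R : realType) (E : normedVectType R)
  (Q : set E) (Qclosed : closed Q)
  (Qconvex : convex_set (Q : set (convex_lmodType E)))
  (d : E -> \bar R) (gradd : E -> {scalar E}) (sigma_d : R) (x0 : E)
  (hd : prox_function Q d gradd sigma_d x0)
  (f : E -> \bar R) (m : E -> E -> \bar R)
  (sigma_f sigmabar_f L delta : R)
  (hL : (0 <= L)%R) (hdelta : (0 <= delta)%R)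
  (hSP : structured_problem Q d gradd f m sigma_f sigmabar_f
           (fun=> L) (fun _ _ => delta))
  (hsolv : subproblems_solvable Q d m sigma_f)
  (xstar : E) (hxstar : argmin_on Q f xstar)
  (hLgt : (sigmabar_f * sigma_d < L)%R)
  (lambda beta : nat -> R)
  (hbeta : forall n, beta n = ((L - sigmabar_f * sigma_d) / sigma_d)%R)
  (hlambda0 : lambda 0%N = 1%R)
  (hlambda : forall k, lambda k.+1 =
     ((beta k.+1 + weight_sum lambda k.+1 * sigma_f) / beta k.+1)%R)
  (phi psi : nat -> E -> \bar R) (x z w xhat : nat -> E)
  (hmethod : classical_method Q d gradd m sigma_f lambda beta
               phi psi x z w xhat) :
  forall k : nat,
    let ld := l_d d gradd (z k.+1) xstar in
    let S := weight_sum lambda k.+1 in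
    let lhs (v : \bar R) :=
      v - f xstar + sigma_f%:E * bregman d gradd (z k.+1) xstar in
    let rhs (r : R) :=
      ((L - sigmabar_f * sigma_d) / sigma_d)%:E * ld * r%:E + delta%:E in
    let rate : R := Num.min
      ((1 - sigma_f * sigma_d
            / (L - sigmabar_f * sigma_d + sigma_f * sigma_d)) ^+ k)%R
      (1 / k.+1%:R)%R in
    let average := (1 / S)%:E * \sum_(i < k.+1) (lambda i)%:E * f (w i.+1) in
    let best := \big[Order.min/+oo]_(i < k.+1) f (w i.+1) in
    (0 <= ld \/ delta = 0%R \/ sigma_f = 0%R \/ k = 0%N ->
       [/\ lhs (f (xhat k)) <= rhs rate,
           lhs average <= rhs rate
         & lhs best <= rhs rate]) /\
    [/\ lhs (f (xhat k)) <= rhs (1 / S)%R,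
        lhs average <= rhs (1 / S)%R
      & lhs best <= rhs (1 / S)%R].
Proof.

(* Finiteness, model inequality and weight recursion *)
have [_ ddom d_ge0 dC1 sd0 dstrong _ _ _] := hd.
have [f_lsc fdom m_lsc mdom m_le sf0 _ sb0 _ _ _ f_upper] := hSP.
have [fNy _ fconvex] := f_lsc.
have dfin u : Q u -> d u \is a fin_num.
  by move=> Qu; rewrite ge0_fin_numE ?d_ge0//; exact: ddom.
have ffin u : Q u -> f u \is a fin_num.
  by move=> Qu; rewrite fin_numE gt_eqF ?fNy// lt_eqF//; exact: fdom.
have mfin y u : Q y -> Q u -> m y u \is a fin_num.
  move=> Qy Qu; have [mNy _ _] := m_lsc y Qy.
  by rewrite fin_numE gt_eqF ?mNy// lt_eqF//; exact: mdom Qu.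
have xi_ge y u : Q y -> Q u ->
    (sigma_d / 2 * `|u - y| ^+ 2)%:E <= bregman d gradd y u.
  by move=> Qy Qu; exact: (bregman_ge _ _ _ dfin) Qconvex dC1 dstrong Qu Qy.
set b := ((L - sigmabar_f * sigma_d) / sigma_d)%R.
have b0 : (0 < b)%R by rewrite /b divr_gt0// subr_gt0.
have bsd : (b * sigma_d = L - sigmabar_f * sigma_d)%R.
  by rewrite /b divfK ?gt_eqF.
have f_le y u : Q y -> Q u ->
    f u <= m y u + b%:E * bregman d gradd y u + delta%:E.
  move=> Qy Qu; apply: le_trans (f_upper u y Qu Qy) _; rewrite leeD2r//.
  have := xi_ge y u Qy Qu.
  rewrite distrC (bregmanE _ _ _ dfin)// -(fineK (mfin _ _ Qy Qu)).
  rewrite -?(EFinM, EFinD, EFinN) !lee_fin.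
  set xi := (fine (d u) - _)%R; set N := (`|_| ^+ 2)%R => xiN.
  have bsb0 : (0 <= b + sigmabar_f)%R.
    by rewrite addr_ge0 ?(ltW b0)//; case/andP: sb0.
  (* The constant [b] is chosen so that [(b + sigmabar_f) * sigma_d = L]: the Bregman terms absorb
     the quadratic one. *)
  have := ler_wpM2l bsb0 xiN.
  rewrite (_ : (_ * (sigma_d / 2 * N) = L / 2 * N)%R); first by lra.
  have LE : L = (b * sigma_d + sigmabar_f * sigma_d)%R by rewrite bsd subrK.
  by rewrite LE; ring.
have lambdaE n : (b * lambda n = b + weight_sum lambda n * sigma_f)%R.
  case: n => [|n]; first by rewrite hlambda0 /weight_sum big_ord0 mul0r addr0 mulr1.
  by rewrite hlambda hbeta -/b mulrC divfK ?gt_eqF.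
have S_ge n : (n%:R <= weight_sum lambda n)%R.
  exact: weight_sum_ge_nat b0 sf0 lambdaE n.
have lambda_gt0 n : (0 < lambda n)%R.
  rewrite -(pmulr_rgt0 _ b0) lambdaE ltr_wpDr// mulr_ge0//.
  exact: le_trans (S_ge n).
have [[zmin wmin _ _ _ _] _ _ xhat0 xhatS] := hmethod.
have Qw i : Q (w i) by have [] := wmin i.
have Qz i : Q (z i) by have [] := zmin i.
have [Qxstar f_min] := hxstar.
have fwE i : f (w i.+1) = (fine (f (w i.+1)))%:E by rewrite fineK// ffin.

(* The three estimates with factor [1 / S] *)
move=> k ld S lhs rhs rate average best.
have S0 : (0 < S)%R by exact: weight_sum_gt0.
pose A := (\sum_(i < k.+1) lambda i * fine (f (w i.+1)))%R.
have ldfin : ld \is a fin_num by rewrite /ld /l_d fin_numD dfin.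
have A_le := weighted_values_le _ _ _ _ _ dfin ffin mfin m_le _ _ _ _ _
  f_le hbeta lambda_gt0 lambdaE _ _ _ _ _ _ hmethod k.+1 _ Qxstar.
rewrite -/A -/S -/ld in A_le.
have xi0 : (0 <= fine (bregman d gradd (z k.+1) xstar))%R.
  have := xi_ge _ _ (Qz k.+1) Qxstar.
  rewrite (bregmanE _ _ _ dfin)// lee_fin => /(le_trans _); apply.
  by rewrite mulr_ge0 ?exprn_ge0 ?divr_ge0 ?(ltW sd0).
have key v : v <= (A / S)%:E -> lhs v <= rhs (1 / S)%R.
  move=> vA; apply: (@le_trans _ _ (lhs (A / S)%:E)).
    by rewrite /lhs leeD2r// leeD2r.
  rewrite /lhs /rhs -(fineK ldfin) -(fineK (ffin _ Qxstar)).
  move: A_le; rewrite (bregmanE _ _ _ dfin)// -?(EFinM, EFinD, EFinN) lee_fin/=.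
  set xi := (fine (d xstar) - _)%R => A_le.
  rewrite div1r -(ler_pM2r S0) !mulrDl !mulNr !divfK ?gt_eqF//.
  by rewrite -/b; lra.
have xhat_le : f (xhat k) <= (A / S)%:E.
  exact: (convex_weighted_mean _ _ _ _ (fun i => fine (f (w i.+1)))
    (fun i => w i.+1) xhat fconvex (fun i => fNy _) lambda_gt0 fwE xhat0 xhatS).
have averageE : average = (A / S)%:E.
  rewrite /average /A div1r (mulrC _ S^-1%R) EFinM -sumEFin; congr (_ * _).
  by apply: eq_bigr => i _; rewrite fwE.
have best_le : best <= (A / S)%:E.
  rewrite /best (eq_bigr (fun i : 'I_k.+1 => (fine (f (w i.+1)))%:E)) => [|i _].
    exact: (bigmin_le_weighted_mean _ _ (fun i => fine (f (w i.+1))) k lambda_gt0).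
  exact: fwE.
have bounds : [/\ lhs (f (xhat k)) <= rhs (1 / S)%R,
    lhs average <= rhs (1 / S)%R & lhs best <= rhs (1 / S)%R].
  by split; apply: key; rewrite ?averageE.

(* Passage from [1 / S] to the explicit rate *)
split=> // cond.
suff rate_ge : rhs (1 / S)%R <= rhs rate.
  by case: bounds => h1 h2 h3; split; exact: le_trans rate_ge.
have rateE : rate = Num.min ((b / (b + sigma_f)) ^+ k)%R (1 / k.+1%:R)%R.
  have pos : (0 < b * sigma_d + sigma_f * sigma_d)%R.
    by apply: ltr_wpDr; [exact: mulr_ge0 sf0 (ltW sd0)|exact: mulr_gt0].
  have pos' : (0 < b + sigma_f)%R by rewrite ltr_wpDr.
  rewrite /rate -bsd; congr (Num.min (_ ^+ k) _)%R.
  by field; rewrite !gt_eqF.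
have invS_le : (1 / S <= rate)%R by rewrite rateE; exact: inv_weight_sum_le.
have rate_le : (rate <= 1 / k.+1%:R)%R by rewrite /rate ge_min lexx orbT.
(* Either [ld] is nonnegative and the right-hand side is monotone in its factor, or [1 / S] and
   [rate] coincide. *)
have [ld0|SE] : 0 <= ld \/ S = (k.+1%:R)%R.
  case: cond => [?|[delta0|[sf_0|k0]]]; [by left|left|right|right].
  (* For [delta = 0], optimality of [xstar] gives [S * f xstar <= A], so [A_le] forces [b * ld] to
     be at least [S * sigma_f] times a nonnegative Bregman distance. *)
  - rewrite -(fineK ldfin) lee_fin -(pmulr_rge0 _ b0).
    have : (S * fine (f xstar) <= A)%R.
      rewrite /S /weight_sum mulr_suml ler_sum// => i _.
      by rewrite ler_wpM2l ?(ltW (lambda_gt0 _))// fine_le ?ffin ?f_min.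
    have := mulr_ge0 (mulr_ge0 (ltW S0) sf0) xi0.
    by move: A_le; rewrite delta0; lra.
  - apply: (weight_sum_nat b); first by rewrite gt_eqF.
    by move=> n; rewrite lambdaE sf_0 mulr0 addr0.
  - by rewrite /S k0 /weight_sum big_ord1.
- rewrite /rhs -(fineK ldfin) -!EFinM -!EFinD lee_fin lerD2r.
  rewrite ler_wpM2l// mulr_ge0 ?(ltW b0)//.
  by rewrite -lee_fin fineK.
- have -> : rate = (1 / S)%R by apply: le_anti; rewrite invS_le SE rate_le.
  exact: lexx.
Qed.
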